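(* Let $\mathfrak A$ be an Abelian group and $\mu$ be an $\mathfrak A$-valued content. Then $\mathcal N_\mu$ is a ring and $\mu$ admits completion. The map $\mu$ is complete if and only if $\mathcal N_\mu$ is a hereditary set. If $\mathcal N$ is a completion ring for $\mu$, then $\mathfrak{C}_{\mathcal N}\mu$ is an $\mathfrak A$-valued content. In particular, $\mathfrak C\mu$, $\mathfrak S\mu$, and $\overline{\mathfrak C}\mu$ are $\mathfrak A$-valued contents.
   Context: $D_\mu$, $R_\mu$ denote the domain and range of a map $\mu$; all maps $\mu$ here have as domain a set of sets. $S[\mu]=\bigcup D_\mu$. A ring (of sets) is a nonempty set of sets closed under union $A\cup B$ and difference $A\setminus B$. A partition of a set $A$ is a family of pairwise disjoint (possibly empty) sets, indexed by a set $I$, whose union is $A$; it is finite if $I$ is finite. An $\mathfrak A$-valued content is a map $\mu$ with $D_\mu$ a ring, $R_\mu\subset\mathfrak A$, and $\mu(A)=\sum_{i\in I}\mu(\mathbf A(i))$ for every $A\in D_\mu$ and every finite partition $\mathbf A\colon I\to D_\mu$ of $A$. For a set of sets $\mathcal K$, $\hat{\mathcal K}=\{A: A\subset B\text{ for some }B\in\mathcal K\}$; $\mathcal K$ is hereditary if every subset of every element of $\mathcal K$ belongs to $\mathcal K$. $A\Delta B=(A\setminus B)\cup(B\setminus A)$. For a map $\mu$ with $\varnothing\in D_\mu$, a set $N\in D_\mu$ is $\mu$-null if $\mu(N')=\mu(\varnothing)$ for every $N'\in D_\mu$ with $N'\subset N$ (for contents $\mu(\varnothing)=0$); $\mathcal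 N_\mu$ is the set of all $\mu$-null sets. The map $\mu$ admits completion if $D_\mu$ is a ring and $\mu(B_1)=\mu(B_2)$ for all $B_1,B_2\in D_\mu$ with $B_1\Delta B_2\in\mathcal N_\mu$. It is complete if it admits completion and $\mathcal N_\mu$ is hereditary. If $\mu$ admits completion, a completion ring for $\mu$ is a ring $\mathcal N$ such that $N\cap B\in\mathcal N$ for all $N\in\mathcal N$, $B\in D_\mu$, and $\mathcal N\cap D_\mu=\mathcal N_\mu$. For sets of sets $\mathcal Q,\mathcal N$, $\Delta(\mathcal Q,\mathcal N)=\{A: A\Delta B\in\mathcal N\text{ for some }B\in\mathcal Q\}$. The $\mathcal N$-completion $\mathfrak C_{\mathcal N}\mu$ is the unique (well-defined) map $\nu$ with $D_\nu=\Delta(D_\mu,\mathcal N)$ and $\nu(A)=\mu(B)$ whenever $A\in D_\nu$, $B\in D_\mu$, $A\Delta B\in\mathcal N$. For $\mu$ admitting completion put $\mathcal N_0[\mu]=\{N\subset S[\mu]: N\cap B\in\mathcal N_\mu\text{ for every }B\in D_\mu\}$ and $\mathcal N[\mu]=\{N\subset S[\mu]: N\cap B\in\hat{\mathcal N}_\mu\text{ for every }B\in D_\mu\}$. The sets $\hat{\mathcal N}_\mu$, $\mathcal N_0[\mu]$, $\mathcal N[\mu]$ are completion rings for $\mu$; the corresponding $\mathcal N$-completions of $\mu$ are denoted $\mathfrak C\mu$ (completion), $\mathfrak S\mu$ (saturation) and $\overline{\mathfrak C}\mu$ (essential completion), respectively. *)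

(* Defs.v *)
From mathcomp Require Import all_boot all_algebra.
From mathcomp Require Import boolp classical_sets.
From mathcomp Require Import measurable_structure.

Set Implicit Arguments.
Unset Strict Implicit.
Unset Printing Implicit Defensive.

Import GRing.Theory.
Local Open Scope classical_set_scope.
Local Open Scope ring_scope.

(* All sets are subsets of an arbitrary ambient type [T], not assumed to be
   covered by the sets in the domain. A map whose domain is a set of sets is a
   function on the subtype [{A : set T | A \in dom}], so it has no values
   outside its domain. *)
Record setmap (T V : Type) := SetMap {
  dom : set (set T);
  app :> dom -> V
}.

(* The library's [setring] asks for [G set0] instead of nonemptiness. *)
Lemma setringP (T : Type) (G : set (set T)) :
  setring G <-> [/\ G !=set0, setU_closed G & setD_closed G].
Proof.
split=> [[G0 GU GD]|[[A GA] GU GD]]; split=> //; first by exists set0.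
by rewrite -(setDv A); exact: GD.
Qed.

(* Unlike the library's [partition], empty pieces are allowed. *)
Definition indexed_partition (T I : Type) (A : set T) (F : I -> set T) :=
  trivIset [set: I] F /\ \bigcup_i F i = A.

Definition is_content (T : Type) (V : zmodType) (mu : setmap T V) :=
  setring (dom mu) /\
  forall (A : dom mu) (I : finType) (F : I -> dom mu),
    indexed_partition (val A) (fun i => val (F i)) ->
    mu A = \sum_(i : I) mu (F i).

Section SetMaps.
Variables (T V : Type).
Implicit Types (mu nu : setmap T V) (K Q N : set (set T)).

Definition hat K : set (set T) := [set A | exists2 B, K B & A `<=` B].

Definition hereditary K := forall A B, K B -> A `<=` B -> K A.

Definition support_set mu : set T := \bigcup_(A in dom mu) A.

(* [E] ranges over the unique element of [dom mu] with underlying set [set0];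
   the notion is only meant for maps with [dom mu set0]. *)
Definition null_sets mu : set (set T) :=
  [set A | dom mu A /\
    forall A' E : dom mu, val A' `<=` A -> val E = set0 -> mu A' = mu E].

Definition admits_completion mu :=
  setring (dom mu) /\
  forall B1 B2 : dom mu, null_sets mu (val B1 `+` val B2) -> mu B1 = mu B2.

Definition is_complete mu :=
  admits_completion mu /\ hereditary (null_sets mu).

Definition completion_ring mu N :=
  [/\ setring N,
      forall A B, N A -> dom mu B -> N (A `&` B) &
      N `&` dom mu = null_sets mu].

Definition Delta Q N : set (set T) :=
  [set A | exists2 B, Q B & N (A `+` B)].

Lemma Delta_witness mu N (A : Delta (dom mu) N) :
  exists B : dom mu, N (val A `+` val B).
Proof.
have [B muB NAB] := set_valP A.
by exists (exist _ B (mem_set muB)).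
Qed.

(* The value at [A] is [mu B] for some chosen [B] with [A `+` B] in [N];
   [NcompletionP] shows that the choice is immaterial when [N] is a completion
   ring. *)
Definition Ncompletion mu N : setmap T V :=
  SetMap (fun A : Delta (dom mu) N => mu (projT1 (cid (Delta_witness A)))).

Definition is_Ncompletion mu N nu :=
  dom nu = Delta (dom mu) N /\
  forall (A : dom nu) (B : dom mu), N (val A `+` val B) -> nu A = mu B.

Lemma NcompletionP mu N nu :
  admits_completion mu -> completion_ring mu N ->
  is_Ncompletion mu N nu <-> nu = Ncompletion mu N.
Proof.
move=> [[_ muU muD] muE] [[_ NU ND] _ Nmu]; split=> [|->].
  case: nu => D f [/= DE]; subst D => fE; congr SetMap; apply: funext => A.
  by case: cid => C NAC; exact: fE NAC.
split=> // A B NAB /=; case: cid => C /= NAC; apply: muE; rewrite -Nmu.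
split; last by apply: muU; apply: muD; exact: set_valP.
have -> : val C `+` val B = (val A `+` val C) `+` (val A `+` val B).
  by rewrite [val A `+` val C]setYC -setYA [val A `+` (_ `+` _)]setYA
             setYK set0Y.
by apply: NU; apply: ND.
Qed.

Definition locally_null mu : set (set T) :=
  [set A | A `<=` support_set mu /\
    forall B, dom mu B -> null_sets mu (A `&` B)].

Definition locally_negligible mu : set (set T) :=
  [set A | A `<=` support_set mu /\
    forall B, dom mu B -> hat (null_sets mu) (A `&` B)].

Definition completion mu := Ncompletion mu (hat (null_sets mu)).
Definition saturation mu := Ncompletion mu (locally_null mu).
Definition essential_completion mu := Ncompletion mu (locally_negligible mu).

End SetMaps.

(* Main.v *)
Require Import Defs.
From mathcomp Require Import all_boot all_algebra.
From mathcomp Require Import boolp classical_sets.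
From mathcomp Require Import measurable_structure.

(** Since the domain of a content is a ring, additivity over finite partitions
    amounts to [mu (A `|` B) = mu A + mu B] for disjoint [A] and [B]
    ([is_contentP]). Cancellation in the group then gives [mu set0 = 0], so a
    set of the domain is null exactly when [mu] vanishes on all its subsets in
    the domain ([null_setsP]). If [B1 `+` B2] is null, both [B1] and [B2]
    differ from [B1 `&` B2] by a null set, hence [mu B1 = mu B2]: every content
    admits completion.

    For a completion ring [N] the difficulty is that [N] need not be
    hereditary: one cannot show that a set belongs to [N] by bounding it by a
    set of [N]. Instead one computes in the Boolean ring of all subsets, with
    sum [`+`] and product [`&`]. If [A1 `+` B1] and [A2 `+` B2] are in [N], then
    [(A1 `&` A2) `+` (B1 `&` B2)] is a sum of products of elements of [N] with
    elements of [N] or of the domain, so it is in [N] ([congr_setI]). As union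
    and difference are Boolean polynomials, [Delta (dom mu) N] is a ring
    ([setring_Delta]). If moreover [A1] and [A2] are disjoint, then
    [B1 `&` B2] lies in [N] and in the domain, so it is null, and additivity of
    [mu] on [B1] and [B2] gives additivity of the completion on [A1] and [A2]
    ([Ncompletion_content]).

    Finally the null sets of a content form a completion ring, and completion
    rings are preserved by passing to the subsets of the support whose traces on
    the sets of the domain all belong to the ring
    ([completion_ring_localize]). Applied to the null sets and to their subsets
    this gives the rings defining the saturation and the essential completion. *)

Set Implicit Arguments.
Unset Strict Implicit.
Unset Printing Implicit Defensive.

Import GRing.Theory.
Local Open Scope classical_set_scope.
Local Open Scope ring_scope.

(** * Boolean identities and rings of sets *)

(** For Boolean identities between at most four sets: the case analysis on
    membership supplies the excluded middle that [tauto] lacks. An identity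
    with fewer sets repeats arguments. *)
Ltac set_cases A B C D :=
  let x := fresh "x" in
  rewrite predeqE; intro x; rewrite /setY /setD /setI /setU /set0 /=;
  case: (pselect (A x)); case: (pselect (B x));
  case: (pselect (C x)); case: (pselect (D x)); tauto.

Section SetRings.
Context {T : Type} {G : set (set T)}.
Hypothesis ringG : setring G.

Lemma setring0 : G set0. Proof. by case: ringG. Qed.

Lemma setringU A B : G A -> G B -> G (A `|` B).
Proof. by case: ringG => _ + _; apply. Qed.

Lemma setringD A B : G A -> G B -> G (A `\` B).
Proof. by case: ringG => _ _; apply. Qed.

Lemma setringI A B : G A -> G B -> G (A `&` B).
Proof. by move=> GA GB; rewrite -setDD; do ?apply: setringD. Qed.

Lemma setringY A B : G A -> G B -> G (A `+` B).
Proof. by move=> GA GB; apply: setringU; apply: setringD. Qed.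

End SetRings.

(** * Contents as additive set functions *)

Section TotalApp.
Context {T : Type} {V : zmodType}.
Implicit Types (mu nu : setmap T V) (A B : set T).

Definition dom_elt mu A (muA : dom mu A) : dom mu := exist _ A (mem_set muA).

(** Extending a map by zero outside its domain makes its values independent of
    membership proofs, so that sets can be rewritten in its argument. *)
Definition total_app mu A : V :=
  if pselect (dom mu A) is left muA then mu (dom_elt muA) else 0.

Lemma total_appE mu (A : dom mu) : mu A = total_app mu (val A).
Proof.
rewrite /total_app; case: pselect => [muA|]; last by case; exact: set_valP.
by congr (app _); exact: val_inj.
Qed.

Definition additive mu := forall A B, dom mu A -> dom mu B ->
  A `&` B = set0 -> total_app mu (A `|` B) = total_app mu A + total_app mu B.

Lemma additive_set0 mu : setring (dom mu) -> additive mu ->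
  total_app mu set0 = 0.
Proof.
move=> ringD /(_ set0 set0 (setring0 ringD) (setring0 ringD)).
rewrite set0I setU0 => /(_ erefl) m0.
by apply: (addrI (total_app mu set0)); rewrite -m0 addr0.
Qed.

Lemma additive_bigsetU mu (I : eqType) (s : seq I) (F : I -> set T) :
  setring (dom mu) -> additive mu -> (forall i, dom mu (F i)) ->
  trivIset [set: I] F -> uniq s ->
  dom mu (\big[setU/set0]_(i <- s) F i) /\
  total_app mu (\big[setU/set0]_(i <- s) F i) =
    \sum_(i <- s) total_app mu (F i).
Proof.
move=> ringD addm muF tF; elim: s => [_|i s IHs] /=.
  by rewrite !big_nil additive_set0//; split=> //; exact: setring0.
case/andP=> nis /IHs[muU mE]; rewrite !big_cons; split; first exact: setringU.
rewrite addm ?mE// big_distrr/= big1_seq// => j /= js.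
apply/eqP; rewrite -[_ == _]negbK; apply/negP => /set0P Fij.
by move: nis; rewrite (tF i j Logic.I Logic.I Fij) js.
Qed.

(** A pair of disjoint sets is a partition indexed by [bool]; conversely,
    adding the pieces one at a time handles any finite partition, the empty one
    through [additive_set0]. *)
Lemma is_contentP mu : is_content mu <-> setring (dom mu) /\ additive mu.
Proof.
split=> -[ringD addm]; split=> //.
  move=> A B muA muB AB0.
  have muU := setringU ringD muA muB.
  pose F (b : bool) : dom mu :=
    if b then dom_elt muA else dom_elt muB.
  have := addm (dom_elt muU) bool F.
  rewrite big_bool !total_appE /=; apply; split; last first.
    rewrite predeqE => x; split=> [[[] _ /=]|[Ax|Bx]]; [by left|by right| |].
    - by exists true.
    - by exists false.
  by move=> [] [] _ _ //= []; rewrite ?[B `&` A]setIC AB0.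
move=> A I F [tF UF]; rewrite total_appE.
have muF i : dom mu (val (F i)) by exact: set_valP.
have [_ mE] := additive_bigsetU ringD addm muF tF (index_enum_uniq I).
transitivity (total_app mu (\big[setU/set0]_(i : I) val (F i))).
  congr total_app; rewrite -UF predeqE => x; split=> [[i _ Fix]|].
    by rewrite (bigD1 i)//=; left.
  by apply: (big_ind (fun B : set T => B x -> (\bigcup_i val (F i)) x)) => //
    [B C IB IC [/IB|/IC]//|i _ Fix]; exists i.
by rewrite mE; apply: eq_bigr => i _; rewrite total_appE.
Qed.

Section Content.
Variable mu : setmap T V.
Hypotheses (ringD : setring (dom mu)) (addm : additive mu).
Local Notation m := (total_app mu).

Lemma total_appID A B : dom mu A -> dom mu B ->
  m A = m (A `&` B) + m (A `\` B).
Proof.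
move=> muA muB; rewrite -addm; [congr m| | |].
- by set_cases A B A B.
- exact: setringI.
- exact: setringD.
- by set_cases A B A B.
Qed.

Lemma null_setsP A : null_sets mu A <->
  dom mu A /\ forall B, dom mu B -> B `<=` A -> m B = 0.
Proof.
split=> -[muA nullA]; split=> //.
  move=> B muB BA.
  have := nullA (dom_elt muB) (dom_elt (setring0 ringD)) BA erefl.
  by rewrite !total_appE /= additive_set0.
move=> B E BA E0; rewrite !total_appE E0 additive_set0//.
by apply: nullA => //; exact: set_valP.
Qed.

Lemma null_sets_dom A : null_sets mu A -> dom mu A.
Proof. by case. Qed.

Lemma null_sets_app A : null_sets mu A -> m A = 0.
Proof. by case/null_setsP => muA; apply. Qed.

Lemma null_sets_sub A B : null_sets mu A -> dom mu B -> B `<=` A ->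
  null_sets mu B.
Proof.
move=> /null_setsP[_ nullA] muB BA; apply/null_setsP; split=> // C muC CB.
by apply: nullA => //; exact: subset_trans BA.
Qed.

Lemma setring_null_sets : setring (null_sets mu).
Proof.
split.
- apply/null_setsP; split=> [|B _]; first exact: setring0.
  by rewrite subset0 => ->; exact: additive_set0.
- move=> A B nullA nullB.
  have muA := null_sets_dom nullA; have muB := null_sets_dom nullB.
  apply/null_setsP; split=> [|C muC CAB]; first exact: setringU.
  rewrite (total_appID muC muA).
  rewrite (null_sets_app (null_sets_sub nullA _ _)); last first.
  + by move=> x [].
  + exact: setringI.
  rewrite (null_sets_app (null_sets_sub nullB _ _)) ?addr0//.
  + exact: setringD.
  + by move=> x [/CAB[]].
- move=> A B nullA nullB; apply: (null_sets_sub nullA).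
    by apply: setringD => //; exact: null_sets_dom.
  by move=> x [].
Qed.

Lemma total_app_setY_null A B : dom mu A -> dom mu B ->
  null_sets mu (A `+` B) -> m A = m B.
Proof.
move=> muA muB nullAB.
rewrite (total_appID muA muB) (total_appID muB muA) setIC.
rewrite (null_sets_app (A := A `\` B)); last first.
  by apply: (null_sets_sub nullAB); [exact: setringD|move=> x; left].
rewrite (null_sets_app (A := B `\` A))//.
by apply: (null_sets_sub nullAB); [exact: setringD|move=> x; right].
Qed.

Lemma content_admits_completion : admits_completion mu.
Proof.
split=> // A B nullAB; rewrite !total_appE.
by apply: total_app_setY_null => //; exact: set_valP.
Qed.

(** * The completion along a completion ring is a content *)

Section Ncompletion.
Variable N : set (set T).
Hypothesis cringN : completion_ring mu N.
Local Notation nu := (Ncompletion mu N).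

Let ringN : setring N. Proof. by case: cringN. Qed.

Let N_setI A B : N A -> dom mu B -> N (A `&` B).
Proof. by case: cringN => _ + _; apply. Qed.

Lemma completion_ring_null A : N A -> dom mu A -> null_sets mu A.
Proof. by move=> NA muA; case: cringN => _ _ <-. Qed.

Lemma total_app_Ncompletion A B : dom mu B -> N (A `+` B) ->
  total_app nu A = m B.
Proof.
move=> muB NAB.
have nuA : dom nu A by exists B.
have [_] := (NcompletionP nu content_admits_completion cringN).2 erefl.
move/(_ (dom_elt nuA) (dom_elt muB) NAB).
by rewrite !total_appE.
Qed.

(** Writing [Ai = Bi + Ni] in the Boolean ring of sets, [A1 A2 + B1 B2] expands
    to [N1 B2 + N2 B1 + N1 N2]. *)
Lemma congr_setI A1 A2 B1 B2 : dom mu B1 -> dom mu B2 ->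
  N (A1 `+` B1) -> N (A2 `+` B2) -> N ((A1 `&` A2) `+` (B1 `&` B2)).
Proof.
move=> mu1 mu2 N1 N2.
have -> : (A1 `&` A2) `+` (B1 `&` B2) =
    ((A1 `+` B1) `&` B2 `+` (A2 `+` B2) `&` B1) `+`
    ((A1 `+` B1) `&` (A2 `+` B2)) by set_cases A1 A2 B1 B2.
by apply: setringY => //; [apply: setringY => //; exact: N_setI
                          |exact: setringI].
Qed.

Lemma congr_setD A1 A2 B1 B2 : dom mu B1 -> dom mu B2 ->
  N (A1 `+` B1) -> N (A2 `+` B2) -> N ((A1 `\` A2) `+` (B1 `\` B2)).
Proof.
move=> mu1 mu2 N1 N2.
have -> : (A1 `\` A2) `+` (B1 `\` B2) =
    (A1 `+` B1) `+` ((A1 `&` A2) `+` (B1 `&` B2)) by set_cases A1 A2 B1 B2.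
by apply: setringY => //; exact: congr_setI.
Qed.

Lemma congr_setU A1 A2 B1 B2 : dom mu B1 -> dom mu B2 ->
  N (A1 `+` B1) -> N (A2 `+` B2) -> N ((A1 `|` A2) `+` (B1 `|` B2)).
Proof.
move=> mu1 mu2 N1 N2.
have -> : (A1 `|` A2) `+` (B1 `|` B2) =
    (A1 `+` B1) `+` ((A2 `\` A1) `+` (B2 `\` B1)) by set_cases A1 A2 B1 B2.
by apply: setringY => //; exact: congr_setD.
Qed.

Lemma setring_Delta : setring (Delta (dom mu) N).
Proof.
split.
- by exists set0; [exact: setring0|rewrite setYK; exact: setring0].
- move=> A1 A2 [B1 mu1 N1] [B2 mu2 N2].
  by exists (B1 `|` B2); [exact: setringU|exact: congr_setU].
- move=> A1 A2 [B1 mu1 N1] [B2 mu2 N2].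
  by exists (B1 `\` B2); [exact: setringD|exact: congr_setD].
Qed.

Lemma Ncompletion_content : is_content nu.
Proof.
apply/is_contentP; split=> [|A1 A2 [B1 mu1 N1] [B2 mu2 N2] A0].
  exact: setring_Delta.
have muI : dom mu (B2 `&` B1) by exact: setringI.
have nullI : null_sets mu (B2 `&` B1).
  apply: completion_ring_null => //.
  by have := congr_setI mu1 mu2 N1 N2; rewrite A0 set0Y setIC.
rewrite (total_app_Ncompletion mu1 N1) (total_app_Ncompletion mu2 N2).
have NU := congr_setU mu1 mu2 N1 N2.
rewrite (total_app_Ncompletion (setringU ringD mu1 mu2) NU).
rewrite (total_appID mu2 mu1) (null_sets_app nullI) add0r -addm//.
- by congr m; set_cases B1 B2 B1 B2.
- exact: setringD.
- by set_cases B1 B2 B1 B2.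
Qed.

End Ncompletion.

(** * The standard completion rings *)

Lemma completion_ring_null_sets : completion_ring mu (null_sets mu).
Proof.
split; first exact: setring_null_sets.
- move=> A B nullA muB; apply: (null_sets_sub nullA); last by move=> x [].
  by apply: setringI => //; exact: null_sets_dom.
- by apply/setIidl => A /null_sets_dom.
Qed.

Lemma completion_ring_hat : completion_ring mu (hat (null_sets mu)).
Proof.
split; first split.
- by exists set0 => //; exact: setring0 setring_null_sets.
- move=> A1 A2 [B1 null1 AB1] [B2 null2 AB2].
  exists (B1 `|` B2); last exact: setUSS.
  exact: setringU setring_null_sets _ _ null1 null2.
- by move=> A1 A2 [B1 null1 AB1] _; exists B1 => // x [/AB1].
- by move=> A B [C nullC AC] _; exists C => // x [/AC].
- rewrite predeqE => A; split=> [[[B nullB AB] muA]|nullA].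
    exact: null_sets_sub AB.
  by split; [exists A|exact: null_sets_dom].
Qed.

(** With [null_sets mu] for [N] this is [locally_null mu], and with its
    hereditary hull it is [locally_negligible mu]; the conversion is used when
    concluding for the saturation and the essential completion. *)
Definition localize (N : set (set T)) : set (set T) :=
  [set A | A `<=` support_set mu /\ forall B, dom mu B -> N (A `&` B)].

(** Closure under intersection with a set [C] of the domain holds because the
    trace of [A `&` C] on [B] is the trace of [A] on [C `&` B]. A set of the
    domain is its own trace on itself, so localizing adds no set of the domain
    that was not already in [N]. *)
Lemma completion_ring_localize N :
  completion_ring mu N -> completion_ring mu (localize N).
Proof.
move=> [ringN N_setI N_null]; split; first split.
- by split=> [x []//|B _]; rewrite set0I; exact: setring0.
- move=> A1 A2 [S1 N1] [S2 N2]; split=> [x [/S1|/S2]//|B muB].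
  by rewrite setIUl; apply: setringU => //; [exact: N1|exact: N2].
- move=> A1 A2 [S1 N1] [_ N2]; split=> [x [/S1]//|B muB].
  have -> : (A1 `\` A2) `&` B = (A1 `&` B) `\` (A2 `&` B).
    by set_cases A1 A2 B B.
  by apply: setringD => //; [exact: N1|exact: N2].
- move=> A C [SA NA] muC; split=> [x [/SA]//|B muB].
  by rewrite -setIA; apply: NA; exact: setringI.
- rewrite predeqE => A; split=> [[[_ NA] muA]|nullA].
    by rewrite -N_null; split=> //; rewrite -(setIid A); exact: NA.
  have muA := null_sets_dom nullA.
  split=> //; split=> [x Ax|B muB]; first by exists A.
  by apply: N_setI => //; move: nullA; rewrite -N_null => -[].
Qed.

End Content.

End TotalApp.

Theorem theorem5p3 (T : Type) (V : zmodType) (mu : setmap T V)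
    (mu_content : is_content mu) :
  setring (null_sets mu) /\
  admits_completion mu /\
  (is_complete mu <-> hereditary (null_sets mu)) /\
  (forall N : set (set T),
     completion_ring mu N -> is_content (Ncompletion mu N)) /\
  (is_content (completion mu) /\
   is_content (saturation mu) /\
   is_content (essential_completion mu)).
Proof.
have [ringD addm] := (is_contentP mu).1 mu_content.
have admits := content_admits_completion ringD addm.
have contentN := Ncompletion_content ringD addm.
have cring_hat := completion_ring_hat ringD addm.
have cring_null := completion_ring_null_sets ringD addm.
split; first exact: setring_null_sets.
do 2![split=> //]; first by split=> [[]|].
split; first exact: contentN.
split; first exact: contentN.
by split; apply: contentN; apply: (completion_ring_localize ringD).
Qed.
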